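(* Let $B>1$ and $N>1$ be integers with $\gcd(N,B)=1$, let $e=\operatorname{ord}(B,N)$, and let $e=dk$ with $d,k$ positive integers. Let $x$ be an integer with $1\le x<N$ and $\gcd(x,N)=1$. Define the long-division sequences by $x_1=x$ and, for $i\ge1$, $a_i=\lfloor Bx_i/N\rfloor$ and $x_{i+1}=Bx_i-a_iN$ (so $0\le x_{i+1}<N$; the $a_i$ are the base-$B$ digits of $x/N=0.a_1a_2a_3\ldots$, which is purely periodic with period $a_1a_2\ldots a_e$). For $j=1,\dots,d$ let $A_j=\sum_{i=1}^{k} a_{(j-1)k+i}B^{k-i}$ (the number whose base-$B$ numeral is the $j$-th block $a_{(j-1)k+1}\ldots a_{jk}$ of the period), and set $$R_d(x)=\sum_{j=1}^d x_{(j-1)k+1},\qquad S_d(x)=\sum_{j=1}^d A_j .$$ Then $$S_d(x)=\frac{R_d(x)}{N}\,(B^k-1),$$ and $S_d(x)\equiv 0 \pmod{B^k-1}$ if and only if $R_d(x)\equiv 0\pmod N$.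
   Context: $\operatorname{ord}(B,N)$ denotes the multiplicative order of $B$ modulo $N$, i.e. the least positive integer $e$ with $B^e\equiv 1\pmod N$. *)

(* Defs.v *)
From mathcomp Require Import all_boot all_order all_algebra.

Set Implicit Arguments.
Unset Strict Implicit.
Unset Printing Implicit Defensive.

Import Order.TTheory GRing.Theory Num.Theory.
Local Open Scope ring_scope.

(* A relation instead of a function, so that no junk value is needed when B is
   not a unit modulo N. *)
Definition is_mulord (B N : int) (e : nat) : Prop :=
  [/\ (0 < e)%N,
      (B ^+ e = 1 %[mod N])%Z
    & forall m : nat, (0 < m)%N -> (B ^+ m = 1 %[mod N])%Z -> (e <= m)%N].

(* For N > 0, the quotient (_ %/ N)%Z is the floor of the rational quotient. *)
Definition longdiv_quo (B N r : int) : int := (B * r %/ N)%Z.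

(* Both sequences are indexed from 1; the values at index 0 are junk. *)
Definition longdiv_rem (B N x : int) (i : nat) : int :=
  iter i.-1 (fun r => B * r - longdiv_quo B N r * N) x.

Definition longdiv_digit (B N x : int) (i : nat) : int :=
  longdiv_quo B N (longdiv_rem B N x i).

Lemma longdiv_rem1 (B N x : int) : longdiv_rem B N x 1 = x.
Proof. by []. Qed.

Lemma longdiv_remS (B N x : int) (i : nat) : (0 < i)%N ->
  longdiv_rem B N x i.+1 =
    B * longdiv_rem B N x i - longdiv_digit B N x i * N.
Proof. by case: i. Qed.

Definition block (B N x : int) (k j : nat) : int :=
  \sum_(1 <= i < k.+1) longdiv_digit B N x (j.-1 * k + i)%N * B ^+ (k - i)%N.

Definition rem_sum (B N x : int) (d k : nat) : int :=
  \sum_(1 <= j < d.+1) longdiv_rem B N x (j.-1 * k + 1)%N.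

Definition block_sum (B N x : int) (d k : nat) : int :=
  \sum_(1 <= j < d.+1) block B N x k j.

(* Main.v *)
(** The recursion [a_i * N = B * x_i - x_(i+1)] telescopes over each block to
    [N * A_j = B^k * x_((j-1)k+1) - x_(jk+1)]. As [B^e = 1] modulo [N], the
    remainder [x_(e+1)] is [x_1], so the leading remainders of the blocks are
    cyclically permuted and summing over [j] gives
    [N * S_d(x) = R_d(x) * (B^k - 1)]. *)
Require Import Defs.
From mathcomp Require Import all_boot all_order all_algebra.
From mathcomp Require Import ring.

Set Implicit Arguments.
Unset Strict Implicit.
Unset Printing Implicit Defensive.

Import Order.TTheory GRing.Theory Num.Theory.
Local Open Scope ring_scope.

(** A long-division step is by definition multiplication by [B] followed by reduction modulo [N];
    the bounds on [x] settle [i = 0], where nothing has been reduced yet. *)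
Lemma longdiv_rem_modz (B N x : int) (i : nat) : 0 <= x < N ->
  longdiv_rem B N x i.+1 = (B ^+ i * x %% N)%Z.
Proof.
move=> /andP[x0 xN]; elim: i => [|i IHi].
  by rewrite longdiv_rem1 expr0 mul1r modz_small // x0.
rewrite longdiv_remS // /longdiv_digit /longdiv_quo -/(modz _ _) IHi.
by rewrite modzMmr mulrA -exprS.
Qed.

Lemma longdiv_rem_period (B N x : int) (e : nat) : 0 <= x < N ->
  (B ^+ e = 1 %[mod N])%Z -> longdiv_rem B N x e.+1 = x.
Proof.
move=> xN Be; rewrite longdiv_rem_modz // -modzMml Be modzMml.
(* Reading [1] as [B ^+ 0] turns the residue back into the first remainder, which is [x]. *)
by rewrite -(expr0 B) -longdiv_rem_modz.
Qed.

Lemma longdiv_digits_telescope (B N x : int) (m k : nat) :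
  N * \sum_(1 <= i < k.+1) longdiv_digit B N x (m + i)%N * B ^+ (k - i)%N =
  B ^+ k * longdiv_rem B N x m.+1 - longdiv_rem B N x (m + k).+1.
Proof.
elim: k => [|k IHk]; first by rewrite big_geq // addn0; ring.
rewrite big_nat_recr //= subnn expr0 mulr1.
(* As in Horner's scheme, appending a digit shifts the earlier ones: a factor [B] comes out of their
   sum. *)
under eq_big_nat => i /andP[_ lt_ik].
  rewrite subSn // exprS mulrCA; over.
rewrite -mulr_sumr mulrDr mulrCA IHk addnS.
by rewrite [longdiv_rem _ _ _ (m + k).+2]longdiv_remS // exprS; ring.
Qed.

(** Periodicity is kept out, so the last remainder survives as a boundary term. In the induction on
    [d], this term turns the coefficient [B ^+ k] of the new block's leading remainder into
    [B ^+ k - 1]. *)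
Lemma mul_block_sum (B N x : int) (d k : nat) :
  N * block_sum B N x d k =
  (B ^+ k - 1) * rem_sum B N x d k + x - longdiv_rem B N x (d * k).+1.
Proof.
elim: d => [|d IHd].
  by rewrite /block_sum /rem_sum !big_geq // mul0n longdiv_rem1; ring.
rewrite [block_sum _ _ _ _ _]big_nat_recr //.
rewrite [rem_sum _ _ _ _ _]big_nat_recr //=.
rewrite -/(block_sum B N x d k) -/(rem_sum B N x d k) mulrDr IHd.
by rewrite longdiv_digits_telescope addn1 -mulSnr; ring.
Qed.

Theorem theorem1 (B N : int) (e d k : nat) (x : int)
    (hB : 1 < B) (hN : 1 < N) (hNB : coprimez N B)
    (he : is_mulord B N e)
    (hd : (0 < d)%N) (hk : (0 < k)%N) (hedk : e = (d * k)%N)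
    (hx1 : 1 <= x) (hxN : x < N) (hxcop : coprimez x N) :
  ((block_sum B N x d k)%:~R : rat) =
    (rem_sum B N x d k)%:~R / N%:~R * (B%:~R ^+ k - 1)
  /\ ((block_sum B N x d k = 0 %[mod B ^+ k - 1])%Z <->
      (rem_sum B N x d k = 0 %[mod N])%Z).
Proof.
have N0 : N != 0 by rewrite gt_eqF // (lt_trans ltr01).
have Bk0 : B ^+ k - 1 != 0 by rewrite subr_eq0 gt_eqF // exprn_egt1 // -lt0n.
have eqSR : N * block_sum B N x d k = (B ^+ k - 1) * rem_sum B N x d k.
  have [_ Be _] := he.
  rewrite mul_block_sum -hedk longdiv_rem_period ?addrK //.
  by rewrite hxN (le_trans ler01).
split.
  have NQ0 : (N%:~R : rat) != 0 by rewrite intr_eq0.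
  apply: (mulfI NQ0); rewrite -intrM eqSR intrM intrB rmorphXn /=.
  by rewrite mulrA [N%:~R * _]mulrC divfK // mulrC.
(* The same cofactor [q] serves both ways: cancelling in [eqSR] exchanges [S = q * (B ^+ k - 1)] and
   [R = q * N]. *)
rewrite !mod0z; split=> /dvdz_mod0P/dvdzP[q Eq]; apply/dvdz_mod0P/dvdzP.
  by exists q; apply: (mulfI Bk0); rewrite -eqSR Eq; ring.
by exists q; apply: (mulfI N0); rewrite eqSR Eq; ring.
Qed.
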